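(* Let $d\ge 2$ be an integer. If the Laurent series $f_d(x)$ is badly approximable, then there exist rational numbers $\beta_k$ such that the monic denominators $q_{n}(x)$ of the convergents of $g_d(x)$ satisfy $$q_{1}(x)=x^{d-1}+\cdots+x+1,\qquad q_{2}(x)=x^d+1,$$ $$q_{2k+1}(x)=(x^{d-1}+\cdots+x+1)\,q_{2k}(x)+\beta_{2k+1}\,q_{2k-1}(x)\quad\text{for all integers }k\ge1,$$ $$q_{2k+2}(x)=(x-1)\,q_{2k+1}(x)+\beta_{2k+2}\,q_{2k}(x)\quad\text{for all integers }k\ge 0.$$
   Context: For an integer $d\ge 2$ define the Laurent series $f_d(x)=\prod_{t=0}^{\infty}(1-x^{-d^t})\in\mathbb{Q}((x^{-1}))$ and $g_d(x)=x^{-d+1}f_d(x)$. Every Laurent series $u(x)\in\mathbb{Q}((x^{-1}))$ has a continued fraction expansion $u(x)=[a_0(x);a_1(x),a_2(x),\ldots]$ with $a_i(x)\in\mathbb{Q}[x]$ (the partial quotients), $a_i$ non-constant for $i\ge1$. For $n\ge0$ the $n$-th convergent is the rational function $[a_0(x);a_1(x),\ldots,a_n(x)]$ in reduced form; here $q_n(x)$ is the denominator, normalized to be monic, of the $n$-th convergent of $g_d(x)$, so $q_0(x)=1$. A Laurent series is badly approximable if the degrees of all its partial quotients are bounded above by an absolute constant. *)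

(* Defs.v *)
From HB Require Import structures.
From mathcomp Require Import all_boot all_order all_algebra.
From mathcomp Require Import boolp classical_sets.

Set Implicit Arguments.
Unset Strict Implicit.
Unset Printing Implicit Defensive.

Import Order.TTheory GRing.Theory Num.Theory.
Local Open Scope ring_scope.

(* Formal power series K[[z]]; z plays the role of x^-1 throughout. *)
Record fps (K : Type) := FPS { fcoef : nat -> K }.

Lemma fpsP (K : Type) (s t : fps K) :
  (forall n, fcoef s n = fcoef t n) <-> s = t.
Proof.
split=> [|-> //]; case: s t => [s] [t] /= e.
by congr FPS; apply/funext.
Qed.

HB.instance Definition _ (K : Type) := gen_eqMixin (fps K).
HB.instance Definition _ (K : Type) := gen_choiceMixin (fps K).

Section PowerSeries.
Variable K : fieldType.
Implicit Types s t r : fps K.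

Definition fpsC (c : K) : fps K := FPS (fun n => if n is 0 then c else 0).
Definition fps_var : fps K := FPS (fun n => (n == 1)%:R).
Definition fps_opp s : fps K := FPS (fun n => - fcoef s n).
Definition fps_add s t : fps K := FPS (fun n => fcoef s n + fcoef t n).
Definition fps_mul s t : fps K :=
  FPS (fun n => \sum_(i < n.+1) fcoef s i * fcoef t (n - i)).

Let addA : associative fps_add.
Proof. by move=> s t r; apply/fpsP => n /=; rewrite addrA. Qed.
Let addC : commutative fps_add.
Proof. by move=> s t; apply/fpsP => n /=; rewrite addrC. Qed.
Let add0 : left_id (fpsC 0) fps_add.
Proof. by move=> s; apply/fpsP => -[|n] /=; rewrite add0r. Qed.
Let addN : left_inverse (fpsC 0) fps_opp fps_add.
Proof. by move=> s; apply/fpsP => -[|n] /=; rewrite addNr. Qed.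

HB.instance Definition _ := GRing.isZmodule.Build (fps K) addA addC add0 addN.

Let mulE s t n :
  fcoef (fps_mul s t) n = \sum_(i < n.+1) fcoef s i * fcoef t (n - i).
Proof. by []. Qed.

Let mul_rev s t n :
  fcoef (fps_mul s t) n = \sum_(i < n.+1) fcoef s (n - i) * fcoef t i.
Proof.
rewrite /= (reindex_inj rev_ord_inj) /=; apply: eq_bigr => i _.
by rewrite subSS subKn // -ltnS.
Qed.

Let mulC : commutative fps_mul.
Proof.
move=> s t; apply/fpsP => n; rewrite mul_rev /=.
by apply: eq_bigr => i _; rewrite mulrC.
Qed.

Let mulA : associative fps_mul.
Proof.
move=> p q r; apply/fpsP => i; rewrite [LHS]mulE [RHS]mul_rev.
pose coef3 j k := fcoef p j * (fcoef q (i - j - k)%N * fcoef r k).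
transitivity (\sum_(j < i.+1) \sum_(k < i.+1 | (k <= i - j)%N) coef3 j k).
  apply: eq_bigr => j _; rewrite mul_rev big_distrr /=.
  by rewrite (big_ord_narrow_leq (leq_subr _ _)).
rewrite (exchange_big_dep predT) //=; apply: eq_bigr => k _.
transitivity (\sum_(j < i.+1 | (j <= i - k)%N) coef3 j k).
  apply: eq_bigl => j; rewrite -ltnS -(ltnS j) -!subSn ?leq_ord //.
  by rewrite -subn_gt0 -(subn_gt0 j) -!subnDA addnC.
rewrite (big_ord_narrow_leq (leq_subr _ _)) big_distrl /=.
by apply: eq_bigr => j _; rewrite /coef3 -!subnDA addnC mulrA.
Qed.

Let mul1 : left_id (fpsC 1) fps_mul.
Proof.
move=> s; apply/fpsP => n /=; rewrite big_ord_recl /= mul1r subn0.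
by rewrite big1 ?addr0 // => i _; rewrite mul0r.
Qed.

Let mulD : left_distributive fps_mul fps_add.
Proof.
move=> s t r; apply/fpsP => n /=; rewrite -big_split /=.
by apply: eq_bigr => i _; rewrite mulrDl.
Qed.

Let one_neq0 : fpsC 1 != 0.
Proof.
by apply/eqP => /fpsP/(_ 0)/= /eqP; rewrite oner_eq0.
Qed.

HB.instance Definition _ :=
  GRing.Zmodule_isComNzRing.Build (fps K) mulA mulC mul1 mulD one_neq0.

Lemma fcoef0 n : fcoef (0 : fps K) n = 0.
Proof. by case: n. Qed.

Lemma fcoef1 n : fcoef (1 : fps K) n = (n == 0)%:R.
Proof. by case: n. Qed.

Lemma fcoefB s t n : fcoef (s - t) n = fcoef s n - fcoef t n.
Proof. by []. Qed.

Lemma fcoefM s t n :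
  fcoef (s * t) n = \sum_(i < n.+1) fcoef s i * fcoef t (n - i).
Proof. by []. Qed.

Lemma fpsC_is_zmod_morphism : zmod_morphism fpsC.
Proof. by move=> a b; apply/fpsP => -[|n] //=; rewrite subr0. Qed.

Lemma fpsC_is_monoid_morphism : monoid_morphism fpsC.
Proof.
split=> // a b; apply/fpsP => n; rewrite fcoefM big_ord_recl /= subn0.
rewrite big1 ?addr0 => [|i _]; last by rewrite /= mul0r.
by case: n => //= n; rewrite mulr0.
Qed.

HB.instance Definition _ :=
  GRing.isZmodMorphism.Build K (fps K) fpsC fpsC_is_zmod_morphism.
HB.instance Definition _ :=
  GRing.isMonoidMorphism.Build K (fps K) fpsC fpsC_is_monoid_morphism.

(* The first n coefficients of the inverse of s, when fcoef s 0 != 0. *)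
Fixpoint fps_inv_seq s (n : nat) : seq K :=
  if n is m.+1 then
    let l := fps_inv_seq s m in
    rcons l ((fcoef s 0)^-1 *
      ((m == 0)%:R - \sum_(i < m) fcoef s i.+1 * l`_(m - i.+1)))
  else [::].

Definition fps_unit : pred (fps K) := fun s => fcoef s 0 != 0.

Definition fps_inv s : fps K :=
  if fps_unit s then FPS (fun n => (fps_inv_seq s n.+1)`_n) else s.

Let size_inv_seq s n : size (fps_inv_seq s n) = n.
Proof. by elim: n => //= n IHn; rewrite size_rcons IHn. Qed.

Let nth_inv_seq s n i : (i < n)%N ->
  (fps_inv_seq s n)`_i = (fps_inv_seq s i.+1)`_i.
Proof.
elim: n => // n IHn; rewrite ltnS leq_eqVlt => /predU1P[-> //|lt_in].
by rewrite [in LHS]/= nth_rcons size_inv_seq lt_in IHn.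
Qed.

Let mulV : {in fps_unit, left_inverse 1 fps_inv *%R}.
Proof.
move=> s; rewrite unfold_in => us; rewrite mulrC; apply/fpsP => n.
rewrite fcoefM fcoef1 /fps_inv /fps_unit us big_ord_recl subn0 /=.
rewrite nth_rcons size_inv_seq ltnn eqxx mulrA divff // mul1r.
apply/eqP; rewrite -addrA eq_sym addrC -subr_eq subrr; apply/eqP; symmetry.
apply/eqP; rewrite addrC subr_eq0; apply/eqP; apply: eq_bigr => i _.
have lt_n : (n - i.+1 < n)%N by rewrite ltn_subrL /= (leq_ltn_trans _ (ltn_ord i)).
rewrite /bump /= add1n; congr (_ * _).
by rewrite (nth_inv_seq s lt_n).
Qed.

Let unitPl s t : t * s = 1 -> fps_unit s.
Proof.
move/fpsP/(_ 0); rewrite fcoefM big_ord1 fcoef1 /= => e.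
by apply/eqP => s0; move/eqP: e; rewrite s0 mulr0 eq_sym oner_eq0.
Qed.

Let inv_out : {in [predC fps_unit], fps_inv =1 id}.
Proof. by move=> s; rewrite inE /fps_inv => /negPf us; rewrite -[fps_unit s]/(s \in fps_unit) us. Qed.

HB.instance Definition _ :=
  GRing.ComNzRing_hasMulInverse.Build (fps K) mulV unitPl inv_out.

Lemma fps_unitE s : (s \is a GRing.unit) = (fcoef s 0 != 0).
Proof. by []. Qed.

Let fcoef_var1 t k :
  fcoef (fps_var * t) k = if k is j.+1 then fcoef t j else 0.
Proof.
rewrite fcoefM; case: k => [|k]; first by rewrite big_ord1 mul0r.
rewrite big_ord_recl mul0r add0r big_ord_recl mul1r big1 ?addr0.
  by rewrite /bump /= subSS subn0.
by move=> i _; rewrite mul0r.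
Qed.

Lemma fcoef_var_mul n s k :
  fcoef (fps_var ^+ n * s) k = if (k < n)%N then 0 else fcoef s (k - n).
Proof.
elim: n k => [|n IHn] k; first by rewrite expr0 mul1r subn0.
by rewrite exprS -mulrA fcoef_var1; case: k => // k; rewrite IHn.
Qed.

Lemma fcoef_varX n k : fcoef (fps_var ^+ n) k = (k == n)%:R.
Proof.
rewrite -[_ ^+ n]mulr1 fcoef_var_mul fcoef1 subn_eq0.
by case: (ltngtP k n).
Qed.

Lemma fps_factor s : s != 0 ->
  exists k t, s = fps_var ^+ k * t /\ t \is a GRing.unit.
Proof.
move=> s0; have ex_k : exists k, fcoef s k != 0.
  apply: contrapT => nk; case/eqP: s0; apply/fpsP => k; rewrite fcoef0.
  by apply/eqP; apply: contrapT => /negP ?; apply: nk; exists k.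
case: (ex_minnP ex_k) => k sk mink.
exists k, (FPS (fun n => fcoef s (n + k))); split.
  apply/fpsP => n; rewrite fcoef_var_mul /=; case: ltnP => [lt_nk|/subnK -> //].
  by apply/eqP; apply: contraLR lt_nk => /mink; rewrite -leqNgt.
by rewrite fps_unitE.
Qed.

Let fps_idomain s t : s * t = 0 -> (s == 0) || (t == 0).
Proof.
move=> st0; apply: contrapT => /negP; rewrite negb_or => /andP[s0 t0].
have [j [s1 [es]]] := fps_factor s0; have [k [t1 [et]]] := fps_factor t0.
rewrite !fps_unitE => t10 s10; move: st0.
rewrite es et mulrACA -exprD => /fpsP/(_ (j + k)%N).
rewrite fcoef_var_mul ltnn subnn fcoef0 fcoefM big_ord1 => /eqP.
by rewrite mulf_eq0 (negPf s10) (negPf t10).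
Qed.

HB.instance Definition _ :=
  GRing.ComUnitRing_isIntegral.Build (fps K) fps_idomain.

End PowerSeries.

Arguments fps_var {K}.

(* K((x^-1)) is the fraction field of K[[z]], with x := z^-1. *)
Definition laurent (K : fieldType) : fieldType := {fraction (fps K)}.

Definition lser (K : fieldType) (s : fps K) : laurent K := FracField.tofrac s.

HB.instance Definition _ (K : fieldType) :=
  GRing.RMorphism.copy (@lser K) (@FracField.tofrac (fps K)).

Local Notation tofrac := (@FracField.tofrac _).

Lemma fracE (R : idomainType) (u : {fraction R}) :
  u = tofrac \n_(repr u)%qT / tofrac \d_(repr u)%qT.
Proof.
have d0 := denom_ratioP (repr u).
apply: (canRL (mulfK _)); first by rewrite tofrac_eq0.
rewrite -{1}(reprK u); unlock FracField.tofrac; rewrite -[LHS]FracField.pi_mul.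
apply/eqmodP; rewrite /= FracField.equivfE /FracField.mulf /=.
by rewrite !numden_Ratio ?mulf_neq0 ?oner_eq0 // !mulr1 mulrC.
Qed.

Lemma lser_inj (K : fieldType) : injective (@lser K).
Proof. by move=> s t /eqP; rewrite tofrac_eq => /eqP. Qed.

Section Laurent.
Variable K : fieldType.
Implicit Types (u : laurent K) (p q : {poly K}).

Definition lvar : laurent K := (lser fps_var)^-1.

Definition lpoly p : laurent K := (map_poly (@lser K \o @fpsC K) p).[lvar].

(* p is the polynomial part of u when u - p(x) lies in x^-1 K[[x^-1]]. *)
Definition is_polypart u p : Prop :=
  exists s : fps K, u - lpoly p = lser (fps_var * s).

Definition polypart u : {poly K} := xget 0 [set p | is_polypart u p]%classic.

Let zF : lser (fps_var : fps K) != 0.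
Proof.
rewrite tofrac_eq0; apply/eqP => /fpsP/(_ 1) /= /eqP.
by rewrite oner_eq0.
Qed.

Lemma lpolyE p n : (size p <= n)%N ->
  lpoly p = \sum_(i < n) lser (fpsC p`_i) * lvar ^+ i.
Proof.
move=> pn; rewrite /lpoly (@horner_coef_wide _ n) => [|].
  by apply: eq_bigr => i _; rewrite coef_map.
exact: leq_trans (size_poly _ _) pn.
Qed.

(* z^n p(1/z) as a power series, for deg p <= n *)
Lemma lpoly_rev p n : (size p <= n.+1)%N ->
  lpoly p = lvar ^+ n * lser (\sum_(i < n.+1) fpsC p`_i * fps_var ^+ (n - i)).
Proof.
move=> pn; rewrite (lpolyE pn) rmorph_sum big_distrr /=; apply: eq_bigr => i _.
rewrite rmorphM rmorphXn /= mulrCA; congr (_ * _).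
have /subnKC e : (i <= n)%N by rewrite -ltnS.
by rewrite /lvar !exprVn -{2}e exprD invfM mulfVK // expf_neq0.
Qed.

Let fcoef_rev p n k :
  fcoef (\sum_(i < n.+1) fpsC p`_i * fps_var ^+ (n - i)) k =
  if (k <= n)%N then p`_(n - k) else 0.
Proof.
have fsum m (F : 'I_m -> fps K) j :
    fcoef (\sum_(i < m) F i) j = \sum_(i < m) fcoef (F i) j.
  elim: m F => [|m IHm] F; first by rewrite !big_ord0 fcoef0.
  by rewrite !big_ord_recl -IHm.
rewrite fsum; under eq_bigr => i _.
  rewrite mulrC fcoef_var_mul.
  have -> : (if (k < n - i)%N then 0 else fcoef (fpsC p`_i) (k - (n - i))) =
            if (k == n - i)%N then p`_i else 0.
    case: (ltngtP k (n - i)) => [//|lt|->]; last by rewrite subnn.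
    by move: lt; rewrite -subn_gt0 /=; case: (_ - _)%N.
  over.
case: leqP => kn; last first.
  rewrite big1 // => i _; case: eqP => // e.
  by move: kn; rewrite e ltnNge leq_subr.
have lt_nk : (n - k < n.+1)%N by rewrite ltnS leq_subr.
rewrite (bigD1 (Ordinal lt_nk)) //= subKn // eqxx big1 ?addr0 // => i ne.
case: eqP => // e; case/eqP: ne; apply: val_inj => /=.
by rewrite e subKn // -ltnS.
Qed.


Lemma laurent_factor u : exists n s, u = lvar ^+ n * lser s.
Proof.
have [a [b [b0 ->]]] : exists a b : fps K, b != 0 /\ u = lser a / lser b.
  exists \n_(repr u)%qT, \d_(repr u)%qT; split; first exact: denom_ratioP.
  exact: fracE.
have [k [t [-> ut]]] := fps_factor b0; exists k, (a * t^-1).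
by rewrite !rmorphM rmorphXn rmorphV // invfM /lvar exprVn mulrCA.
Qed.

Lemma polypart_exists u : exists p, is_polypart u p.
Proof.
have [n [s ->]] := laurent_factor u.
pose p : {poly K} := \poly_(j < n.+1) fcoef s (n - j).
exists p, (FPS (fun k => fcoef s (k + n.+1))).
rewrite (@lpoly_rev p n) ?size_poly // -mulrBr -rmorphB.
set r := (\sum_(i < n.+1) _ * _).
have -> : s - r = fps_var ^+ n * (fps_var * FPS (fun k => fcoef s (k + n.+1))).
  rewrite mulrA -exprSr; apply/fpsP => k; rewrite fcoef_var_mul /=.
  rewrite /r fcoef_rev ltnS coef_poly ltnS leq_subr.
  by case: leqP => kn; rewrite ?subKn ?subrr // subr0 subnK.
by rewrite rmorphM rmorphXn mulrA -exprMn mulVf // expr1n mul1r.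
Qed.

Lemma polypart_unique u p q : is_polypart u p -> is_polypart u q -> p = q.
Proof.
move=> [s es] [t et]; apply/eqP; rewrite -subr_eq0.
pose n := (size (p - q)).-1.
have : lpoly (p - q) = lser (fps_var * (t - s)).
  rewrite mulrBr rmorphB /= -es -et opprB [RHS]addrC addrA subrK.
  by rewrite /lpoly rmorphB hornerD hornerN.
rewrite (@lpoly_rev _ n) ?leqSpred // => e.
have {}e : \sum_(i < n.+1) fpsC (p - q)`_i * fps_var ^+ (n - i) =
           fps_var ^+ n * (fps_var * (t - s)).
  apply: lser_inj; rewrite rmorphM rmorphXn /= -e mulrA -exprMn mulfV //.
  by rewrite expr1n mul1r.
rewrite -lead_coef_eq0 lead_coefE -/n; apply/eqP.
move/fpsP/(_ 0): e; rewrite fcoef_rev leq0n subn0 => ->.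
by rewrite mulrA -exprSr fcoef_var_mul.
Qed.

Lemma polypartP u p : is_polypart u p <-> polypart u = p.
Proof.
have [p0 up0] := polypart_exists u.
have up : is_polypart u (polypart u) by apply: (xgetPex 0); exists p0.
by split=> [/(polypart_unique up)|<-].
Qed.

(* The partial quotients a_0, ..., a_n; the list is shorter when the
   expansion of u terminates before a_n. *)
Fixpoint pquots u (n : nat) : seq {poly K} :=
  let a := polypart u in
  a :: (if n is m.+1 then
          let r := u - lpoly a in if r == 0 then [::] else pquots r^-1 m
        else [::]).

Definition badly_approximable u : Prop :=
  exists B : nat, forall n, all (fun a : {poly K} => ((size a).-1 <= B)%N) (pquots u n).

Fixpoint cf_value (a : seq {poly K}) : {fraction {poly K}} :=
  match a with
  | [::] => 0
  | [:: b] => tofrac b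
  | b :: a' => tofrac b + (cf_value a')^-1
  end.

(* When the expansion terminates before a_n, this is its full value, i.e. the
   rational function u. *)
Definition convergent u (n : nat) : {fraction {poly K}} :=
  cf_value (pquots u n).

Definition monic_denom (r : {fraction {poly K}}) : {poly K} :=
  let a := \n_(repr r)%qT in
  let b := \d_(repr r)%qT in
  let q := b %/ gcdp a b in
  (lead_coef q)^-1 *: q.

Lemma monic_denomP r q :
  monic_denom r = q <->
  q \is monic /\ exists2 p, coprimep p q & r = tofrac p / tofrac q.
Proof.
have uniq p1 q1 p2 q2 : q1 \is monic -> q2 \is monic -> coprimep p1 q1 ->
    tofrac p1 / tofrac q1 = tofrac p2 / tofrac q2 -> q1 %| q2.
  move=> m1 m2 co12 /eqP; rewrite eqr_div ?tofrac_eq0 ?monic_neq0 //.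
  rewrite -!rmorphM tofrac_eq => /eqP e.
  by rewrite -(Gauss_dvdpr _ (_ : coprimep q1 p1)) ?e ?dvdp_mull // coprimep_sym.
have [m [p co er]] : monic_denom r \is monic /\ exists2 p,
    coprimep p (monic_denom r) & r = tofrac p / tofrac (monic_denom r).
  have := fracE r; rewrite /monic_denom.
  set a := \n_ _; set b := \d_ _ => er.
  have b0 : b != 0 by exact: denom_ratioP.
  have g0 : gcdp a b != 0 by rewrite gcdp_eq0 negb_and b0 orbT.
  set q1 := b %/ _; have eb : q1 * gcdp a b = b by rewrite divpK ?dvdp_gcdr.
  have q10 : q1 != 0 by apply: contraNneq b0 => q10; rewrite -eb q10 mul0r.
  have c0 : (lead_coef q1)^-1 != 0 by rewrite invr_eq0 lead_coef_eq0.
  split; first by rewrite monicE lead_coefZ mulVf // lead_coef_eq0.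
  exists ((lead_coef q1)^-1 *: (a %/ gcdp a b)).
    rewrite coprimepZl // coprimepZr // coprimep_div_gcd //.
    by rewrite b0 orbT.
  have ea : (a %/ gcdp a b) * gcdp a b = a by rewrite divpK ?dvdp_gcdl.
  apply/eqP; rewrite er eqr_div ?tofrac_eq0 ?scaler_eq0 ?negb_or ?c0 //.
  rewrite -!rmorphM tofrac_eq -scalerAr -scalerAl.
  by rewrite -[X in _ == _ *: (_ * X)]eb -[X in _ *: (X * _) == _]ea mulrAC mulrA.
split=> [<-|[m' [p' co' er']]]; first by split=> //; exists p.
have e : tofrac p / tofrac (monic_denom r) = tofrac p' / tofrac q.
  by rewrite -er.
apply/eqP; rewrite -eqp_monic // /eqp.
by rewrite (uniq _ _ _ _ m m' co e) (uniq _ _ _ _ m' m co' (esym e)).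
Qed.

Definition convergent_denom u n := monic_denom (convergent u n).

End Laurent.

Arguments lvar {K}.

(* The partial products of prod_t (1 - z^(d^t)), and their z-adic limit: for
   d >= 2 the coefficient of z^n no longer changes after the factor t = n. *)
Definition mahler_partial (d m : nat) : fps rat :=
  \prod_(t < m) (1 - fps_var ^+ (d ^ t)).

Definition mahler_series (d : nat) : fps rat :=
  FPS (fun n => fcoef (mahler_partial d n.+1) n).

Lemma mahler_seriesP (d n m : nat) : (2 <= d)%N -> (n < m)%N ->
  fcoef (mahler_partial d m) n = fcoef (mahler_series d) n.
Proof.
move=> d2; elim: m => // m IHm; rewrite ltnS leq_eqVlt => /predU1P[<- //|lt_nm].
have -> : mahler_partial d m.+1 =
          mahler_partial d m - fps_var ^+ (d ^ m) * mahler_partial d m.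
  by rewrite /mahler_partial big_ord_recr /= mulrBr mulr1 [X in _ - X]mulrC.
rewrite -IHm // fcoefB fcoef_var_mul (ltn_trans lt_nm) ?subr0 //.
exact: ltn_expl.
Qed.

Definition mahler_f (d : nat) : laurent rat := lser (mahler_series d).

Definition mahler_g (d : nat) : laurent rat := lvar ^- (d - 1) * mahler_f d.

(* Main.v *)
Require Import Defs.
From HB Require Import structures.
From mathcomp Require Import all_boot all_order all_algebra.
From mathcomp Require Import zify ring.

(** Write [f], [g] for the two series, [h = f / x], and [S] for the polynomial
    1 + x + ... + x^(d-1).  From [f(x) = (1 - 1/x) f(x^d)] one gets
    [h(x) = (x - 1) x^(d-2) h(x^d)] and [g(x) = (x - 1) h(x^d)].

    The hypothesis is used for [h].  If [q h - p] has degree at most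
    [- deg q - (a + 1)], then substituting [x^d] and multiplying by
    [(x - 1) x^(d-2)] gives an approximation whose denominator is [q(x^d)] and
    whose excess is [d a + 1] instead of [a + 1].  Starting from [a >= 1] and
    iterating, the excess is unbounded, which is impossible when [f], hence
    [h], is badly approximable; so no excess is ever above 1
    ([poorly_approximable_h2]).  Likewise no denominator [R] of a convergent of
    [h] vanishes at 1, because [R(x^d)] could then be divided by [x - 1] and
    would give an excess of 3 ([denominator_root1]).  Hence all partial
    quotients of [h] of positive index are linear, and the k-th denominator
    [R_k] has degree [k].

    Let [S_k] be the numerator that goes with [R_k], and [P_n / Q_n] the
    convergents of [g].  The pair [R_k(x^d)], [(x - 1) S_k(x^d)] is coprime and
    its error for [g] has degree [1 - d (k + 1)].  By Legendre's criterion
    ([legendre_coprime]) it is a convergent of [g], and the next denominator has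
    degree [d (k + 1) - 1]; comparing degrees, its index is [2k]
    ([cf_g_even]).  The partial quotients of [g] of positive index thus have
    degrees [d - 1] and 1 alternately.

    It remains to find them up to a constant factor.  The products of
    [Q_(2k+1)] and [P_(2k+1)] by the linear partial quotient [a_(2k+2)] are
    [F(x^d)] and [(x - 1) G(x^d)]; unless [a_(2k+2)] vanishes at 1, the
    symmetry of [F(x^d)] and [G(x^d)] under d-th roots of unity creates a
    common factor of [P_(2k+1)] and [Q_(2k+1)].  So [a_(2k+2)] is a multiple of
    [x - 1] and [S] divides [Q_(2k+1)] ([pquot_g_even]).  Consequently [S]
    divides [a_(2k+1) Q_(2k)], and it is coprime to [Q_(2k)] since
    [R_k(1) <> 0], so that [a_(2k+1)] is a multiple of [S] ([pquot_g_odd]).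

    Terminating expansions also have bounded partial quotients, so that the
    argument needs the irrationality of [f]: the functional equation would give
    a rational [f] two different orders of vanishing at 1
    ([irrational_mahler_f]). *)

Set Implicit Arguments.
Unset Strict Implicit.
Unset Printing Implicit Defensive.

Import Order.TTheory GRing.Theory Num.Theory.
Local Open Scope ring_scope.

(** * Degrees of Laurent series *)

Section Degree.
Variable K : fieldType.
Implicit Types (u v w : laurent K) (s t : fps K) (p q : {poly K}) (a b m : int).

Lemma lvar_neq0 : (lvar : laurent K) != 0.
Proof.
rewrite invr_eq0 tofrac_eq0; apply/eqP => /fpsP/(_ 1%N)/eqP.
by rewrite /= oner_eq0.
Qed.

Lemma lser_var n : lser (fps_var ^+ n : fps K) = lvar ^ (- n%:Z).
Proof. by rewrite rmorphXn -exprnN /lvar -exprVn invrK. Qed.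

HB.instance Definition _ := GRing.RMorphism.copy (@lpoly K)
  (horner_eval (lvar : laurent K) \o map_poly (@lser K \o @fpsC K)).

Lemma lpolyC (c : K) : lpoly c%:P = lser (fpsC c).
Proof. by rewrite /lpoly map_polyC /= hornerC. Qed.

Lemma lpolyX : lpoly ('X : {poly K}) = lvar.
Proof. by rewrite /lpoly map_polyX hornerX. Qed.

(** As [x^-1] is the uniformizer, [degle u m] says that the degree of [u] in
    [x] is at most [m], with degree minus infinity for [u = 0]; [hasdeg] gives
    the exact degree of a nonzero series. *)
Definition degle u m : Prop := exists s, u = lvar ^ m * lser s.

Definition hasdeg u m : Prop :=
  exists2 s, s \is a GRing.unit & u = lvar ^ m * lser s.

Lemma hasdeg_le u m : hasdeg u m -> degle u m.
Proof. by case=> s _ ->; exists s. Qed.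

Lemma degle0 m : degle 0 m.
Proof. by exists 0; rewrite rmorph0 mulr0. Qed.

Lemma degle_trans u a b : a <= b -> degle u a -> degle u b.
Proof.
move=> ab [s ->]; exists (fps_var ^+ `|b - a| * s).
rewrite rmorphM /= lser_var mulrA -expfzDr ?lvar_neq0 //.
by congr (_ ^ _ * _); lia.
Qed.

Lemma degleD u v m : degle u m -> degle v m -> degle (u + v) m.
Proof. by move=> [s ->] [t ->]; exists (s + t); rewrite -mulrDr -rmorphD. Qed.

Lemma degleN u m : degle u m -> degle (- u) m.
Proof. by move=> [s ->]; exists (- s); rewrite -mulrN -rmorphN. Qed.

Lemma degleB u v m : degle u m -> degle v m -> degle (u - v) m.
Proof. by move=> um vm; apply: degleD => //; exact: degleN. Qed.

Lemma degleM u v a b : degle u a -> degle v b -> degle (u * v) (a + b).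
Proof.
move=> [s ->] [t ->]; exists (s * t).
by rewrite mulrACA -rmorphM -expfzDr ?lvar_neq0.
Qed.

Lemma hasdeg_neq0 u m : hasdeg u m -> u != 0.
Proof.
case=> s; rewrite fps_unitE => s0 ->; rewrite mulf_neq0 //.
  by rewrite expfz_eq0 (negPf lvar_neq0) andbF.
by rewrite tofrac_eq0; apply: contraNneq s0 => ->.
Qed.

Lemma hasdegM u v a b : hasdeg u a -> hasdeg v b -> hasdeg (u * v) (a + b).
Proof.
move=> [s us ->] [t ut ->]; exists (s * t); first by rewrite unitrM us.
by rewrite mulrACA -rmorphM -expfzDr ?lvar_neq0.
Qed.

Lemma hasdegV u a : hasdeg u a -> hasdeg u^-1 (- a).
Proof.
move=> [s us ->]; exists s^-1; first by rewrite unitrV.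
by rewrite invfM invr_expz rmorphV.
Qed.

Lemma hasdegN u a : hasdeg u a -> hasdeg (- u) a.
Proof.
by move=> [s us ->]; exists (- s); rewrite ?unitrN // -mulrN -rmorphN.
Qed.

Lemma hasdeg_ex u : u != 0 -> exists m, hasdeg u m.
Proof.
have [n [s ->]] := laurent_factor u; move=> us0.
have s0 : s != 0.
  by apply: contraNneq us0 => ->; rewrite rmorph0 mulr0.
have [k [t [-> ut]]] := fps_factor s0; exists (n%:Z - k%:Z), t => //.
by rewrite rmorphM /= lser_var mulrA exprnP expfzDr ?lvar_neq0.
Qed.

Lemma hasdeg_min u a b : hasdeg u a -> degle u b -> a <= b.
Proof.
move=> [s us ->] [t e]; rewrite leNgt; apply/negP => ba.
have {}e : s = fps_var ^+ `|a - b| * t.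
  apply: lser_inj; rewrite rmorphM /= lser_var.
  apply: (mulfI (x := lvar ^ a)).
    by rewrite expfz_eq0 (negPf lvar_neq0) andbF.
  rewrite e mulrA -expfzDr ?lvar_neq0 //; congr (_ ^ _ * _); lia.
by move: us; rewrite fps_unitE e fcoef_var_mul; case: ltnP; [rewrite eqxx|lia].
Qed.

Lemma hasdeg_uniq u a b : hasdeg u a -> hasdeg u b -> a = b.
Proof.
move=> ua ub; apply/le_anti; rewrite (hasdeg_min ua (hasdeg_le ub)).
exact: hasdeg_min ub (hasdeg_le ua).
Qed.

Lemma hasdegD u v a b : b < a -> hasdeg u a -> degle v b -> hasdeg (u + v) a.
Proof.
move=> ba [s us ->] [t ->]; exists (s + fps_var ^+ `|a - b| * t).
  rewrite fps_unitE -[fcoef _ _]/(fcoef s 0 + fcoef (_ * _) 0) fcoef_var_mul.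
  by case: ltnP => [_|]; [rewrite addr0 -fps_unitE|lia].
rewrite rmorphD mulrDr; congr (_ + _).
rewrite rmorphM /= lser_var mulrA -expfzDr ?lvar_neq0 //.
by congr (_ ^ _ * _); lia.
Qed.

(** Factoring [x^n] out of a polynomial of degree [n] leaves a power series
    whose constant coefficient is the leading coefficient. *)
Lemma hasdeg_poly p : p != 0 -> hasdeg (lpoly p) (size p).-1%:Z.
Proof.
move=> p0; pose n := (size p).-1.
rewrite (@lpoly_rev _ p n) ?leqSpred //.
exists (\sum_(i < n.+1) fpsC p`_i * fps_var ^+ (n - i)) => //.
have fsum k (F : 'I_k -> fps K) :
    fcoef (\sum_(i < k) F i) 0 = \sum_(i < k) fcoef (F i) 0.
  elim: k F => [|k IHk] F; first by rewrite !big_ord0.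
  by rewrite !big_ord_recl -IHk.
rewrite fps_unitE fsum big_ord_recr big1 => [|i _].
  rewrite [_ 0 _]add0r mulrC fcoef_var_mul /= subnn /=.
  by rewrite -lead_coefE lead_coef_eq0.
by rewrite mulrC fcoef_var_mul /= subn_gt0 ltn_ord.
Qed.

Lemma degle_poly p : degle (lpoly p) (size p).-1%:Z.
Proof.
have [->|p0] := eqVneq p 0; first by rewrite rmorph0; exact: degle0.
exact/hasdeg_le/hasdeg_poly.
Qed.

Lemma poly_degle p m : p != 0 -> degle (lpoly p) m -> (size p).-1%:Z <= m.
Proof. by move=> /hasdeg_poly; exact: hasdeg_min. Qed.

Lemma degle_poly_neg p m : m < 0 -> degle (lpoly p) m -> p = 0.
Proof.
move=> m0 pm; apply/eqP; apply: contraT => p0.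
by have := poly_degle p0 pm; lia.
Qed.

Lemma lpoly_inj : injective (@lpoly K).
Proof.
move=> p q e; apply/eqP; rewrite -subr_eq0; apply/eqP.
apply: (@degle_poly_neg _ (-1)) => //; rewrite rmorphB /= e subrr.
exact: degle0.
Qed.

Lemma lpoly_eq0 p : (lpoly p == 0) = (p == 0).
Proof. by rewrite -(inj_eq lpoly_inj) rmorph0. Qed.

Lemma polypart_deg u : degle (u - lpoly (polypart u)) (-1).
Proof.
have [p up] := polypart_exists u; have ep := (polypartP u p).1 up.
case: up => s es; exists s; rewrite ep es -[fps_var in LHS]expr1.
by rewrite rmorphM /= lser_var.
Qed.

End Degree.

(** * Continuants *)

Section Continuants.
Variable K : fieldType.
Implicit Types (a b : {poly K}) (l : seq {poly K}).

(** The continuants of a list and of its tail are the numerator and the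
    denominator of the continued fraction with these partial quotients. The
    tail of the empty list gets the value 0, which plays the role of the
    denominator of index -1 and makes the recurrences uniform. *)
Fixpoint continuant l : {poly K} :=
  if l is a :: l' then
    a * continuant l' + (if l' is _ :: l'' then continuant l'' else 0)
  else 1.

Definition tl_continuant l : {poly K} :=
  if l is _ :: l' then continuant l' else 0.

Lemma continuant_cons a l :
  continuant (a :: l) = a * continuant l + tl_continuant l.
Proof. by []. Qed.

Lemma continuant_rcons2 l a b :
  continuant (rcons (rcons l a) b) =
    b * continuant (rcons l a) + continuant l /\
  tl_continuant (rcons (rcons l a) b) =
    b * tl_continuant (rcons l a) + tl_continuant l.
Proof.
elim: l => [|c l [IHK IHT]] /=.
  by split; rewrite ?mulr1 ?addr0 //; ring.
rewrite -!/(tl_continuant _) IHK IHT; split=> //; ring.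
Qed.

Definition nonconstant (a : {poly K}) : bool := (1 < size a)%N.

(** [size_mul] with all sizes taken over the field [K] itself, so that linear
    arithmetic identifies them with the other sizes. *)
Lemma size_polyM a b : a != 0 -> b != 0 ->
  size (a * b) = (size a + size b).-1.
Proof. exact: size_mul. Qed.

Lemma size_tl_continuant l :
  all nonconstant l -> (size (tl_continuant l) < size (continuant l))%N.
Proof.
elim: l => [_|a l IHl]; first by rewrite size_poly0 size_poly1.
move=> /andP[]; rewrite -[tl_continuant _]/(continuant l) /nonconstant.
move=> a1 /IHl lt_l.
have n0 : continuant l != 0 by rewrite -size_poly_gt0; lia.
have na : a != 0 by rewrite -size_poly_gt0 ltnW.
have sm := size_polyM na n0.
by rewrite continuant_cons size_polyDl sm; lia.
Qed.

Lemma size_continuant_cons a l : (1 < size a)%N -> all nonconstant l ->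
  size (continuant (a :: l)) = ((size a).-1 + size (continuant l))%N.
Proof.
move=> a1 /size_tl_continuant lt_l.
have n0 : continuant l != 0 by rewrite -size_poly_gt0; lia.
have na : a != 0 by rewrite -size_poly_gt0 ltnW.
have sm := size_polyM na n0.
by rewrite continuant_cons size_polyDl sm; lia.
Qed.

Lemma size_continuant_rcons l a : (1 < size a)%N -> all nonconstant l ->
  size (continuant (rcons l a)) = ((size a).-1 + size (continuant l))%N.
Proof.
move=> a1; elim: l => [_|b l IHl].
  by rewrite size_continuant_cons.
move=> /[dup] /= /andP[b1 nl] nbl.
rewrite -/(continuant (b :: rcons l a)) -/(continuant (b :: l)).
rewrite !size_continuant_cons // ?IHl //.
  by rewrite addnCA.
by rewrite all_rcons /nonconstant a1.
Qed.

Lemma coprimep_continuant l : coprimep (continuant l) (tl_continuant l).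
Proof.
elim: l => [|a l IHl]; first exact: coprime1p.
by rewrite continuant_cons coprimep_sym coprimep_addl_mul.
Qed.

Lemma cf_value_continuant a l : all nonconstant l ->
  cf_value (a :: l) = FracField.tofrac (continuant (a :: l)) /
                      FracField.tofrac (continuant l).
Proof.
elim: l a => [|b l IHl] a nl; first by rewrite /= mulr1 addr0 rmorph1 divr1.
have nz : FracField.tofrac (continuant (b :: l)) != 0.
  rewrite tofrac_eq0 -size_poly_gt0.
  exact: leq_ltn_trans (size_tl_continuant nl).
rewrite -[LHS]/(FracField.tofrac a + (cf_value (b :: l))^-1).
rewrite IHl; last by case/andP: nl.
rewrite invf_div (continuant_cons a); move: (continuant (b :: l)) nz => c c0.
by rewrite rmorphD rmorphM mulrDl mulfK.
Qed.

End Continuants.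

(** * Convergents of irrational Laurent series *)

Section Convergents.
Variable K : fieldType.
Implicit Types (u : laurent K) (p q : {poly K}).

(** This excludes the terminating expansions, for which [pquots u n] stops
    before index [n]. *)
Definition irrational u : Prop :=
  forall p q, q != 0 -> lpoly q * u <> lpoly p.

Definition cfnext u : laurent K := (u - lpoly (polypart u))^-1.

Definition pquot u n : {poly K} := polypart (iter n cfnext u).

Definition cfnum u n : {poly K} := continuant (pquots u n).

Definition cfden u n : {poly K} := tl_continuant (pquots u n).

Lemma irrational_neq u p : irrational u -> u - lpoly p != 0.
Proof.
move=> iu; rewrite subr_eq0; apply/eqP => e.
by apply: (iu p 1); rewrite ?oner_neq0 // rmorph1 mul1r.
Qed.

Lemma irrational_next u : irrational u -> irrational (cfnext u).
Proof.
move=> iu p q q0; set a := polypart u; rewrite /cfnext -/a => e.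
have ua := irrational_neq a iu.
have p0 : p != 0.
  by rewrite -lpoly_eq0 -e mulf_neq0 ?invr_eq0 // lpoly_eq0.
apply: (iu (q + p * a) p p0).
rewrite rmorphD rmorphM /=; apply/eqP; rewrite -subr_eq -mulrBr -e.
by rewrite divfK.
Qed.

Lemma pquotsS u n : irrational u ->
  pquots u n.+1 = polypart u :: pquots (cfnext u) n.
Proof. by move=> iu /=; rewrite (negPf (irrational_neq _ iu)). Qed.

Lemma pquots_rcons u n : irrational u ->
  pquots u n.+1 = rcons (pquots u n) (pquot u n.+1).
Proof.
elim: n u => [|n IHn] u iu; first by rewrite pquotsS.
have iv := irrational_next iu.
by rewrite pquotsS // IHn // [in RHS]pquotsS // /pquot -iterSr.
Qed.

Lemma hasdeg_polypart u m : 0 <= m -> hasdeg u m ->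
  hasdeg (lpoly (polypart u)) m.
Proof.
move=> m0 um; rewrite -[lpoly _](subKr u).
apply: (@hasdegD _ _ _ _ (-1)) => //.
exact/degleN/polypart_deg.
Qed.

Lemma hasdeg_next u : irrational u ->
  hasdeg (cfnext u) (size (polypart (cfnext u))).-1%:Z /\
  (1 < size (polypart (cfnext u)))%N.
Proof.
move=> iu; have [m um] := hasdeg_ex (irrational_neq (polypart u) iu).
have m1 := hasdeg_min um (polypart_deg u).
have vm := hasdegV um; rewrite -/(cfnext u) in vm.
have am := hasdeg_polypart (_ : 0 <= - m) vm.
have {}am : hasdeg (lpoly (polypart (cfnext u))) (- m) by apply: am; lia.
have a0 : polypart (cfnext u) != 0.
  by rewrite -lpoly_eq0 (hasdeg_neq0 am).
have e := hasdeg_uniq am (hasdeg_poly a0); rewrite -e; split=> //.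
lia.
Qed.

Lemma size_pquot u n : irrational u -> (1 < size (pquot u n.+1))%N.
Proof.
elim: n u => [|n IHn] u iu; first exact: (hasdeg_next iu).2.
by rewrite /pquot iterSr; apply: IHn; exact: irrational_next.
Qed.

Lemma nonconstant_pquots u n : irrational u ->
  all (@nonconstant K) (pquots (cfnext u) n).
Proof.
move=> iu; elim: n => [|n IHn].
  by apply/andP; split=> //; exact: (hasdeg_next iu).2.
rewrite pquots_rcons ?all_rcons; last exact: irrational_next.
by rewrite IHn andbT /pquot -iterSr; exact: (size_pquot n.+1 iu).
Qed.

Lemma cfdenS u n : irrational u -> cfden u n.+1 = cfnum (cfnext u) n.
Proof. by move=> iu; rewrite /cfden pquotsS. Qed.

Lemma cfnumS u n : irrational u ->
  cfnum u n.+1 = polypart u * cfnum (cfnext u) n + cfden (cfnext u) n.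
Proof. by move=> iu; rewrite /cfnum pquotsS // continuant_cons. Qed.

Lemma cfden0 u : cfden u 0 = 1.
Proof. by []. Qed.

Lemma cfden1 u : irrational u -> cfden u 1 = pquot u 1.
Proof. by move=> iu; rewrite cfdenS // /cfnum /= mulr1 addr0. Qed.

Lemma cfden_rec u n : irrational u ->
  cfden u n.+2 = pquot u n.+2 * cfden u n.+1 + cfden u n.
Proof.
move=> iu; rewrite /cfden (pquots_rcons n.+1) // (pquots_rcons n) //.
by rewrite (continuant_rcons2 _ _ _).2.
Qed.

Lemma cfnum_rec u n : irrational u ->
  cfnum u n.+2 = pquot u n.+2 * cfnum u n.+1 + cfnum u n.
Proof.
move=> iu; rewrite /cfnum (pquots_rcons n.+1) // (pquots_rcons n) //.
by rewrite (continuant_rcons2 _ _ _).1.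
Qed.

Lemma size_cfdenS u n : irrational u ->
  size (cfden u n.+1) = ((size (pquot u n.+1)).-1 + size (cfden u n))%N.
Proof.
move=> iu; case: n => [|n].
  rewrite cfden1 // cfden0 size_poly1.
  by have := size_pquot 0 iu; case: size => // k; rewrite addn1.
rewrite !cfdenS // /cfnum pquots_rcons; last exact: irrational_next.
rewrite size_continuant_rcons /pquot -?iterSr //; first exact: size_pquot.
exact: nonconstant_pquots.
Qed.

Lemma size_cfden_lt u n : irrational u ->
  (size (cfden u n) < size (cfden u n.+1))%N.
Proof.
by move=> iu; rewrite size_cfdenS //; have := size_pquot n iu; lia.
Qed.

Lemma size_cfden_ltn u m n : irrational u ->
  (size (cfden u m) < size (cfden u n))%N = (m < n)%N.
Proof.
move=> iu; have mono : {homo (fun k => size (cfden u k)) : i j / (i < j)%N}.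
  by apply: homo_ltn => [x y z|k]; [exact: ltn_trans|exact: size_cfden_lt].
exact: (leqW_mono (leq_mono mono)).
Qed.

Lemma size_cfden_gt u n : irrational u -> (n < size (cfden u n))%N.
Proof.
move=> iu; elim: n => [|n IHn]; first by rewrite cfden0 size_poly1.
exact: leq_ltn_trans IHn (size_cfden_lt n iu).
Qed.

Lemma cfden_neq0 u n : irrational u -> cfden u n != 0.
Proof.
by move=> iu; rewrite -size_poly_gt0 (leq_ltn_trans _ (size_cfden_gt n iu)).
Qed.

Lemma coprimep_cf u n : coprimep (cfnum u n) (cfden u n).
Proof. exact: coprimep_continuant. Qed.

Lemma convergent_denomE u n : irrational u ->
  convergent_denom u n = (lead_coef (cfden u n))^-1 *: cfden u n.
Proof.
move=> iu; have q0 := cfden_neq0 n iu.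
have c0 : (lead_coef (cfden u n))^-1 != 0 by rewrite invr_eq0 lead_coef_eq0.
apply/monic_denomP; split.
  by rewrite monicE lead_coefZ mulVf // lead_coef_eq0.
exists ((lead_coef (cfden u n))^-1 *: cfnum u n).
  by rewrite coprimepZl // coprimepZr // coprimep_cf.
have -> : convergent u n =
    FracField.tofrac (cfnum u n) / FracField.tofrac (cfden u n).
  rewrite /convergent /cfnum /cfden; case: n {q0 c0} => [|n].
    by rewrite cf_value_continuant.
  by rewrite pquotsS // cf_value_continuant // nonconstant_pquots.
rewrite -!mul_polyC !rmorphM /= invfM mulrACA divff ?mul1r //.
by rewrite tofrac_eq0 polyC_eq0.
Qed.

Lemma tail_error (F : fieldType) (x y a v : F) : v != 0 ->
  x * (a + v^-1) - (a * x + y) = - ((y * v - x) / v).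
Proof. by move=> v0; field. Qed.

Lemma cross_error (R : comRingType) (u x y p q : R) :
  x * q - p * y = y * (q * u - p) - q * (y * u - x).
Proof. by ring. Qed.

(** With [u = a_0 + 1 / v], the error of the convergent of index [n + 1] of
    [u] is, up to sign, that of the convergent of index [n] of [v], divided
    by [v]; and [v] has the same degree as its own polynomial part. *)
Lemma cf_error u n : irrational u ->
  hasdeg (lpoly (cfden u n) * u - lpoly (cfnum u n))
    (- (size (cfden u n.+1)).-1%:Z).
Proof.
elim: n u => [|n IHn] u iu; have [vd sv] := hasdeg_next iu.
  rewrite cfden1 // cfden0 rmorph1 mul1r /cfnum /= mulr1 addr0.
  by rewrite -[u - _]invrK; exact: hasdegV.
have iv := irrational_next iu; have v0 := hasdeg_neq0 vd.
have eu : u = lpoly (polypart u) + (cfnext u)^-1.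
  by rewrite /cfnext invrK addrC subrK.
have -> : lpoly (cfden u n.+1) * u - lpoly (cfnum u n.+1) =
    - ((lpoly (cfden (cfnext u) n) * cfnext u - lpoly (cfnum (cfnext u) n)) *
       (cfnext u)^-1).
  by rewrite cfnumS // cfdenS // rmorphD rmorphM
             -(tail_error _ _ (lpoly (polypart u)) v0) -eu.
apply: hasdegN.
have -> : - (size (cfden u n.+2)).-1%:Z =
    - (size (cfden (cfnext u) n.+1)).-1%:Z
    + - (size (polypart (cfnext u))).-1%:Z :> int.
  rewrite (cfdenS n.+1) // /cfnum pquotsS // size_continuant_cons //;
    last first.
    exact: nonconstant_pquots.
  rewrite cfdenS // -/(cfnum _ n).
  have : (0 < size (cfnum (cfnext (cfnext u)) n))%N.
    by rewrite -cfdenS // (leq_ltn_trans _ (size_cfden_gt n.+1 iv)).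
  lia.
exact: hasdegM (IHn _ iv) (hasdegV vd).
Qed.

(** If [deg Q_n <= deg q < deg Q_(n+1)], then the
    polynomial [q P_n - p Q_n] has negative degree, hence vanishes. *)
Lemma legendre u p q m : irrational u -> q != 0 ->
  m < - (size q).-1%:Z -> degle (lpoly q * u - lpoly p) m ->
  exists n t, q = t * cfden u n /\ p = t * cfnum u n.
Proof.
move=> iu q0 mq qm.
have q1 : (0 < size q)%N by rewrite size_poly_gt0.
have [n le_nq lt_qn] : exists2 n, (size (cfden u n) <= size q)%N
                                & (size q < size (cfden u n.+1))%N.
  have ex : exists n, (size q < size (cfden u n))%N.
    by exists (size q); exact: size_cfden_gt.
  case: (ex_minnP ex) => -[|n] lt_q minn.
    by move: lt_q; rewrite cfden0 size_poly1; lia.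
  exists n => //; rewrite leqNgt; apply/negP => /minn; lia.
have Q0 := cfden_neq0 n iu.
have Q1 : (0 < size (cfden u n))%N by rewrite size_poly_gt0.
exists n.
have e : cfnum u n * q = p * cfden u n.
  apply/eqP; rewrite -subr_eq0; apply/eqP.
  apply: (@degle_poly_neg _ _ (-1)) => //.
  have -> : lpoly (cfnum u n * q - p * cfden u n) =
      lpoly (cfden u n) * (lpoly q * u - lpoly p)
      - lpoly q * (lpoly (cfden u n) * u - lpoly (cfnum u n)).
    by rewrite rmorphB !rmorphM (cross_error u).
  apply: degleB.
    by apply: degle_trans (degleM (degle_poly _) qm); lia.
  apply: degle_trans (degleM (degle_poly _) (hasdeg_le (cf_error n iu))).
  lia.
have /dvdpP[t et] : cfden u n %| q.
  rewrite -(Gauss_dvdpr _ (_ : coprimep (cfden u n) (cfnum u n))).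
    by rewrite e dvdp_mulIr.
  by rewrite coprimep_sym coprimep_cf.
exists t; split=> //; apply: (mulIf Q0).
by rewrite -e et mulrCA mulrA.
Qed.

(** In the setting of [legendre], coprimality makes the factor [t] a constant,
    so that the degree of the error determines that of [Q_(n+1)]. *)
Lemma legendre_coprime u p q (N : nat) : irrational u -> coprimep p q ->
  q != 0 -> (size q <= N)%N -> hasdeg (lpoly q * u - lpoly p) (- N%:Z) ->
  exists n c, [/\ c != 0, cfden u n = c *: q, cfnum u n = c *: p &
    size (cfden u n.+1) = N.+1].
Proof.
move=> iu co q0 qN qd.
have q1 : (0 < size q)%N by rewrite size_poly_gt0.
have mq : - N%:Z < - (size q).-1%:Z by lia.
have [n [t [eq ep]]] := legendre iu q0 mq (hasdeg_le qd).
have /size_poly1P[c c0 et] : size t == 1%N.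
  by rewrite -coprimepp; apply: coprimep_dvdr (coprimep_dvdl _ co);
    rewrite ?eq ?ep dvdp_mulIl.
exists n, c^-1; rewrite eq ep et !mul_polyC !scalerA mulVf // !scale1r.
split=> //; first by rewrite invr_eq0.
have := cf_error n iu.
have ec : hasdeg (lpoly t) 0.
  have := hasdeg_poly (_ : t != 0); rewrite et size_polyC c0; apply.
  by rewrite polyC_eq0.
move=> /(hasdegM ec); rewrite mulrBr mulrA -!rmorphM -eq -ep.
move=> /hasdeg_uniq/(_ qd).
have := size_cfden_gt n.+1 iu; lia.
Qed.

Definition poorly_approximable_by u (B : nat) : Prop :=
  forall p q, q != 0 ->
    ~ degle (lpoly q * u - lpoly p) (- (size q).-1%:Z - B%:Z).

(** A better approximation than allowed would be a multiple [t (Q_n, P_n)] of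
    a convergent, and would then force a jump from [deg Q_n] to
    [deg Q_(n+1)] larger than [B]. *)
Lemma badly_approximableP u : irrational u -> badly_approximable u ->
  exists B, poorly_approximable_by u B.
Proof.
move=> iu [B bB]; exists B.+1 => p q q0 qd.
have mq : - (size q).-1%:Z - B.+1%:Z < - (size q).-1%:Z by lia.
have [n [t [eq ep]]] := legendre iu q0 mq qd.
have t0 : t != 0 by apply: contraNneq q0 => t0; rewrite eq t0 mul0r.
move: qd; rewrite {1}eq ep !rmorphM -mulrA -mulrBr /=.
move=> /(hasdeg_min (hasdegM (hasdeg_poly t0) (cf_error n iu))).
rewrite eq size_polyM // ?cfden_neq0 // size_cfdenS //.
have := bB n.+1; rewrite pquots_rcons // all_rcons => /andP[].
have : (0 < size t)%N by rewrite size_poly_gt0.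
have : (0 < size (cfden u n))%N by rewrite size_poly_gt0 cfden_neq0.
lia.
Qed.

End Convergents.

(** * The substitution of x^d for x *)

Section Dilation.
Variables (K : fieldType) (d : nat).
Hypothesis d_gt0 : (0 < d)%N.
Implicit Types (u v : laurent K) (s t : fps K) (p q : {poly K}).

Definition fps_dilate s : fps K :=
  FPS (fun n => if (d %| n)%N then fcoef s (n %/ d) else 0).

Lemma fps_dilateD s t : fps_dilate (s + t) = fps_dilate s + fps_dilate t.
Proof.
by apply/fpsP => n; rewrite /=; case: ifP => // _; rewrite addr0.
Qed.

Lemma fps_dilateN s : fps_dilate (- s) = - fps_dilate s.
Proof. by apply/fpsP => n; rewrite /=; case: ifP => // _; rewrite oppr0. Qed.

Lemma fps_dilateM s t : fps_dilate (s * t) = fps_dilate s * fps_dilate t.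
Proof.
apply/fpsP => n; rewrite [RHS]fcoefM.
rewrite -[LHS]/(if (d %| n)%N then fcoef (s * t) (n %/ d) else 0) fcoefM.
case: ifPn => [/dvdnP[m ->]|dn]; last first.
  rewrite big1 // => i _ /=; case: ifP => di; last by rewrite mul0r.
  case: ifP => dni; last by rewrite mulr0.
  case/negP: dn; rewrite -(subnK (leq_ord i)) dvdn_add //.
rewrite mulnK // [RHS](bigID (fun i : 'I_(m * d).+1 => d %| i)%N) /=.
rewrite [X in _ = _ + X]big1 ?addr0 => [|i /negPf->]; last by rewrite mul0r.
have bound (j : 'I_m.+1) : (j * d < (m * d).+1)%N.
  by rewrite ltnS leq_mul2r -ltnS ltn_ord orbT.
rewrite (reindex_onto (fun j => Ordinal (bound j))
                      (fun i => inord (i %/ d))) /=; last first.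
  move=> i di; apply: val_inj; rewrite /= inordK ?divnK //.
  by rewrite ltnS leq_divLR // -ltnS.
apply: eq_big => [j|j _]; last first.
  by rewrite dvdn_mull // mulnK // -mulnBl dvdn_mull // mulnK.
by rewrite dvdn_mull // mulnK // inord_val eqxx.
Qed.

Lemma fps_dilate1 : fps_dilate 1 = 1.
Proof.
apply/fpsP => -[|n] /=; first by rewrite dvdn0 div0n.
by case: ifP => // /dvdnP[[|m] e] //; rewrite e mulnK.
Qed.

Lemma fps_dilate_varX m : fps_dilate (fps_var ^+ m) = fps_var ^+ (d * m).
Proof.
apply/fpsP => n; rewrite fcoef_varX.
rewrite -[LHS]/(if (d %| n)%N then fcoef (fps_var ^+ m) (n %/ d) else 0).
rewrite fcoef_varX; case: ifPn => [/dvdnP[k ->]|dn]; last first.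
  by case: eqP dn => // ->; rewrite dvdn_mulr.
by rewrite mulnK // mulnC eqn_pmul2l.
Qed.

Lemma fps_dilateC (c : K) : fps_dilate (fpsC c) = fpsC c.
Proof.
apply/fpsP => -[|n] /=; first by rewrite dvdn0 div0n.
by case: ifP => // /dvdnP[[|m] e] //; rewrite e mulnK.
Qed.

Lemma fcoef_dilate0 s : fcoef (fps_dilate s) 0 = fcoef s 0.
Proof. by rewrite /= dvdn0 div0n. Qed.

Lemma fps_dilate_eq0 s : (fps_dilate s == 0) = (s == 0).
Proof.
apply/eqP/eqP => [/fpsP s0|->]; apply/fpsP => n.
  by rewrite fcoef0 -(fcoef0 K (n * d)) -s0 /= dvdn_mull // mulnK.
rewrite fcoef0 -[LHS]/(if (d %| n)%N then fcoef 0 (n %/ d) else 0).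
by rewrite fcoef0 if_same.
Qed.

(** Numerator and denominator of a representative are dilated separately;
    [dilate_frac] shows that the choice of the fraction does not matter. *)
Definition dilate u : laurent K :=
  lser (fps_dilate \n_(repr u)%qT) / lser (fps_dilate \d_(repr u)%qT).

Lemma dilate_frac s t : t != 0 ->
  dilate (lser s / lser t) = lser (fps_dilate s) / lser (fps_dilate t).
Proof.
move=> t0; rewrite /dilate; set u := lser s / lser t.
have d0 : \d_(repr u)%qT != 0 by exact: denom_ratioP.
have := fracE u; rewrite {1}/u => /eqP.
rewrite eqr_div ?tofrac_eq0 // -!rmorphM (inj_eq (@lser_inj K)) => /eqP e.
apply/eqP; rewrite eqr_div ?tofrac_eq0 ?fps_dilate_eq0 //.
by rewrite -!rmorphM -!fps_dilateM (inj_eq (@lser_inj K)) e.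
Qed.

Lemma dilate_ser s : dilate (lser s) = lser (fps_dilate s).
Proof.
rewrite -[lser s]divr1 -(rmorph1 (@lser K)) dilate_frac ?oner_neq0 //.
by rewrite fps_dilate1 rmorph1 divr1.
Qed.

Lemma frac_ex u : exists s t, t != 0 /\ u = lser s / lser t.
Proof.
exists \n_(repr u)%qT, \d_(repr u)%qT; split; first exact: denom_ratioP.
exact: fracE.
Qed.

Lemma dilateM u v : dilate (u * v) = dilate u * dilate v.
Proof.
have [a [b [b0 ->]]] := frac_ex u; have [s [t [t0 ->]]] := frac_ex v.
rewrite mulf_div -!rmorphM !dilate_frac ?mulf_neq0 //.
by rewrite !fps_dilateM !rmorphM mulf_div.
Qed.

Lemma dilateD u v : dilate (u + v) = dilate u + dilate v.
Proof.
have [a [b [b0 ->]]] := frac_ex u; have [s [t [t0 ->]]] := frac_ex v.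
rewrite addf_div ?tofrac_eq0 // -!rmorphM -rmorphD !dilate_frac ?mulf_neq0 //.
rewrite fps_dilateD !fps_dilateM rmorphD !rmorphM addf_div //.
  by rewrite tofrac_eq0 fps_dilate_eq0.
by rewrite tofrac_eq0 fps_dilate_eq0.
Qed.

Lemma dilateN u : dilate (- u) = - dilate u.
Proof.
have [a [b [b0 ->]]] := frac_ex u.
by rewrite -mulNr -rmorphN !dilate_frac // fps_dilateN rmorphN mulNr.
Qed.

Lemma dilateV u : dilate u^-1 = (dilate u)^-1.
Proof.
have [a [b [b0 ->]]] := frac_ex u; have [->|a0] := eqVneq a 0.
  by rewrite rmorph0 mul0r invr0 -(rmorph0 (@lser K)) dilate_ser
             (eqP (_ : fps_dilate 0 == 0)) ?fps_dilate_eq0 // rmorph0 invr0.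
by rewrite invf_div !dilate_frac // invf_div.
Qed.

Lemma dilate_var : dilate lvar = lvar ^+ d.
Proof.
rewrite /lvar dilateV dilate_ser -[fps_var]expr1 fps_dilate_varX muln1.
by rewrite rmorphXn exprVn.
Qed.

Lemma dilate_poly p : dilate (lpoly p) = lpoly (p \Po 'X^d).
Proof.
elim/poly_ind: p => [|p c IHp].
  by rewrite comp_poly0 -[X in lpoly X]/(0%:P) lpolyC dilate_ser fps_dilateC.
rewrite comp_polyD comp_polyM comp_polyX comp_polyC !rmorphD !rmorphM /=.
rewrite !lpolyC lpolyX dilateD dilateM dilate_var dilate_ser fps_dilateC IHp.
by rewrite rmorphXn /= lpolyX.
Qed.

Lemma dilate_varz m : dilate (lvar ^ m) = lvar ^ (d%:Z * m).
Proof.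
have dX n : dilate (lvar ^+ n) = lvar ^+ (d * n).
  elim: n => [|n IHn].
    by rewrite muln0 expr0 -(rmorph1 (@lser K)) dilate_ser fps_dilate1.
  by rewrite exprS dilateM IHn dilate_var -exprD mulnS.
case: m => n; first by rewrite -exprnP dX exprnP PoszM.
by rewrite NegzE -exprnN dilateV dX mulrN -PoszM exprnN.
Qed.

Lemma degle_dilate u m : degle u m -> degle (dilate u) (d%:Z * m).
Proof.
by case=> s ->; exists (fps_dilate s); rewrite dilateM dilate_varz dilate_ser.
Qed.

Lemma hasdeg_dilate u m : hasdeg u m -> hasdeg (dilate u) (d%:Z * m).
Proof.
case=> s us ->; exists (fps_dilate s); last first.
  by rewrite dilateM dilate_varz dilate_ser.
by rewrite fps_unitE fcoef_dilate0.
Qed.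

Lemma size_comp_Xn p : (size (p \Po 'X^d)).-1 = (d * (size p).-1)%N.
Proof. by rewrite size_comp_poly size_polyXn mulnC. Qed.

Lemma comp_Xn_neq0 p : p != 0 -> p \Po 'X^d != 0.
Proof.
move=> p0; rewrite -lpoly_eq0 -dilate_poly.
exact: hasdeg_neq0 (hasdeg_dilate (hasdeg_poly p0)).
Qed.

(** A zero [c] of a polynomial in [x^d] comes with all the other d-th roots of
    [c^d]. *)
Lemma dvdp_comp_Xn p c : root (p \Po 'X^d) c ->
  'X^d - (c ^+ d)%:P %| p \Po 'X^d.
Proof.
rewrite /root horner_comp hornerXn -/(root _ _) => /factor_theorem[r ->].
by rewrite comp_polyM rmorphB /= comp_polyX comp_polyC dvdp_mulIr.
Qed.

(** Since [x^d - 1] has a simple zero at 1 when [d] is invertible, the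
    substitution keeps the order of vanishing at 1. *)
Lemma mup_comp_Xn p : d%:R != 0 :> K -> p != 0 ->
  mup 1 (p \Po 'X^d) = mup 1 p.
Proof.
move=> d0 p0.
have [m [q]] := multiplicity_XsubC p 1; rewrite p0 /= => q1 ep.
pose S : {poly K} := \sum_(i < d) 'X^i.
have S1 : ~~ root (S ^+ m) 1.
  rewrite /root horner_exp expf_eq0 negb_and; apply/orP; right.
  rewrite horner_sum (eq_bigr (fun=> 1)) => [|i _]; last first.
    by rewrite hornerXn expr1n.
  by rewrite sumr_const card_ord.
have qd1 : ~~ root (q \Po 'X^d) 1.
  by rewrite /root horner_comp hornerXn expr1n.
rewrite {1}ep comp_polyM rmorphXn rmorphB /= comp_polyX comp_polyC polyC1.
rewrite subrX1 -/S mupMr // exprMn mupMl // ep mupMr //.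
Qed.

End Dilation.

(** * The Mahler series *)

Lemma mul_swap (R : comRingType) (x y v w a b : R) :
  x * v = y * w -> a * (b * v) * x = y * (b * (a * w)).
Proof. by move=> e; transitivity (a * b * (x * v)); [|rewrite e]; ring. Qed.

Lemma mul_regroup (R : comRingType) (a b c v : R) :
  a * (b * c * v) = c * (a * b * v).
Proof. by ring. Qed.

Section Mahler.
Variable d : nat.
Hypothesis d_ge2 : (2 <= d)%N.

Implicit Types p q : {poly rat}.

Let d_gt0 : (0 < d)%N := ltnW d_ge2.

Local Notation f := (mahler_f d).
Local Notation g := (mahler_g d).

Lemma mahler_partialS m :
  mahler_partial d m.+1 = (1 - fps_var) * fps_dilate d (mahler_partial d m).
Proof.
rewrite /mahler_partial big_ord_recl expn0 expr1; congr (_ * _).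
rewrite (big_morph _ (fps_dilateM d_gt0) (fps_dilate1 _ d_gt0)).
apply: eq_bigr => i _.
by rewrite fps_dilateD fps_dilateN fps_dilate1 // fps_dilate_varX // -expnS.
Qed.

Lemma mahler_seriesE :
  mahler_series d = (1 - fps_var) * fps_dilate d (mahler_series d).
Proof.
apply/fpsP => n; rewrite -(@mahler_seriesP d n n.+2) // mahler_partialS.
rewrite [LHS]fcoefM [RHS]fcoefM; apply: eq_bigr => i _; congr (_ * _) => /=.
case: ifP => // _; apply: mahler_seriesP => //.
by rewrite ltnS (leq_trans (leq_div _ _)) // leq_subr.
Qed.

Lemma mahler_series0 : fcoef (mahler_series d) 0 = 1.
Proof.
rewrite -(@mahler_seriesP d 0 1) // /mahler_partial big_ord1.
by rewrite fcoefB fcoef1 fcoef_varX subr0.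
Qed.

Lemma mahler_f_neq0 : f != 0.
Proof.
rewrite tofrac_eq0; apply/eqP => e; have := mahler_series0.
by rewrite e fcoef0 => /eqP; rewrite eq_sym oner_eq0.
Qed.

Lemma mahler_fE : lvar * f = (lvar - 1) * dilate d f.
Proof.
rewrite /mahler_f dilate_ser // {1}mahler_seriesE rmorphM mulrA; congr (_ * _).
rewrite rmorphB rmorph1 mulrBr mulr1; congr (_ - _).
by rewrite /lvar mulVf // -invr_eq0 lvar_neq0.
Qed.

Lemma lpolyX1 : lpoly ('X - 1 : {poly rat}) = lvar - 1.
Proof. by rewrite rmorphB rmorph1 /= lpolyX. Qed.

(** A relation [q f = p] would give
    [x p(x) q(x^d) = (x - 1) p(x^d) q(x)], in which the two sides do not
    vanish to the same order at 1. *)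
Lemma irrational_mahler_f : irrational f.
Proof.
move=> p q q0 e; have p0 : p != 0.
  by rewrite -lpoly_eq0 -e mulf_neq0 ?mahler_f_neq0 // lpoly_eq0.
have ed : lpoly (q \Po 'X^d) * dilate d f = lpoly (p \Po 'X^d).
  by rewrite -!dilate_poly // -dilateM // e.
have {e ed} e : (q \Po 'X^d) * p * 'X = ('X - 1) * (q * (p \Po 'X^d)).
  apply: lpoly_inj; rewrite !rmorphM /= lpolyX1 lpolyX -e -ed.
  exact: mul_swap mahler_fE.
have q'0 := comp_Xn_neq0 d_gt0 q0; have p'0 := comp_Xn_neq0 d_gt0 p0.
have d0 : d%:R != 0 :> rat by rewrite pnatr_eq0 -lt0n.
have := congr1 (mup 1) e.
have X1 : 'X - 1 = ('X - 1%:P) ^+ 1 :> {poly rat} by rewrite expr1 polyC1.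
rewrite mupMl; last by rewrite /root hornerX oner_eq0.
have X0 : ('X - 1%:P) ^+ 1 != 0 :> {poly rat} by rewrite expr1 polyXsubC_eq0.
rewrite X1 !mupM ?mulf_neq0 // mup_XsubCX eqxx !mup_comp_Xn //.
by lia.
Qed.

Lemma irrational_mahler_g : irrational g.
Proof.
move=> p q q0 e; apply: (irrational_mahler_f (p := p * 'X^(d - 1)) q0).
rewrite rmorphM rmorphXn /= lpolyX -e /mahler_g -mulrA; congr (_ * _).
by rewrite mulrC mulrA divff ?mul1r // expf_neq0 ?lvar_neq0.
Qed.

(** The series [h = f / x]: multiplied by suitable polynomials, [h(x^d)] gives
    both [h] and [g], so that approximations of [h] yield, by substitution,
    approximations of [h] itself and of [g]. *)
Definition mahler_h : laurent rat := lvar^-1 * f.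

Local Notation h := mahler_h.

Lemma mahler_gE : g = lpoly ('X - 1) * dilate d h.
Proof.
rewrite lpolyX1 /mahler_h dilateM // dilateV // dilate_var //.
rewrite mulrCA -mahler_fE /mahler_g mulrA; congr (_ * _).
have x0 : (lvar : laurent rat) != 0 by exact: lvar_neq0.
by rewrite -{2}(subnK d_gt0) addn1 exprS invfM mulrAC mulVf // mul1r.
Qed.

Lemma mahler_hE : h = lpoly (('X - 1) * 'X^(d - 2)) * dilate d h.
Proof.
rewrite rmorphM rmorphXn /= lpolyX mulrAC -mahler_gE /mahler_g mulrC mulrA.
congr (_ * _); have x0 : (lvar : laurent rat) != 0 by exact: lvar_neq0.
have -> : (d - 1)%N = (d - 2).+1 by lia.
by rewrite exprS invfM mulrCA mulfV ?mulr1 // expf_neq0.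
Qed.

Lemma poorly_approximable_h B : poorly_approximable_by f B ->
  poorly_approximable_by h B.+1.
Proof.
move=> fB p q q0 qh; apply: (fB ('X * p) q q0).
have -> : lpoly q * f - lpoly ('X * p) = lvar * (lpoly q * h - lpoly p).
  rewrite rmorphM /= lpolyX mulrBr; congr (_ - _).
  by rewrite mulrCA /mahler_h mulVKf // lvar_neq0.
have x1 : degle (lvar : laurent rat) 1.
  by exists 1; rewrite rmorph1 mulr1 expr1z.
by apply: degle_trans (degleM x1 qh); lia.
Qed.

(** Substituting [x^d] in [q h - p] and using the functional equation turns an
    excess of [a + 1] in the degree of approximation into [d a + 1]. *)
Lemma dilate_approximation p q (a : nat) : q != 0 ->
  degle (lpoly q * h - lpoly p) (- (size q).-1%:Z - a.+1%:Z) ->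
  exists p', degle (lpoly (q \Po 'X^d) * h - lpoly p')
               (- (size (q \Po 'X^d)).-1%:Z - (d * a).+1%:Z).
Proof.
move=> q0 qh; exists (('X - 1) * 'X^(d - 2) * (p \Po 'X^d)).
rewrite {1}mahler_hE [lpoly (_ * (p \Po _))]rmorphM /= mulrCA -mulrBr.
rewrite -!dilate_poly // -dilateM // -dilateN // -dilateD //.
have P := degle_poly (('X - 1) * 'X^(d - 2) : {poly rat}).
apply: degle_trans (degleM P (degle_dilate d_gt0 qh)).
rewrite size_comp_Xn -polyC1 size_Mmonic ?polyXsubC_eq0 ?monicXn //.
rewrite size_XsubC size_polyXn; move: (size q).-1 => s; nia.
Qed.

(** Repeated substitution makes any excess above 1 grow without bound. *)
Lemma poorly_approximable_h2 B : poorly_approximable_by h B ->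
  poorly_approximable_by h 2.
Proof.
move=> hB p q q0; move: q0 (leqnn B) (isT : (0 < 1)%N).
(* Each substitution increases [a]; [n] bounds how many are still needed. *)
suff H n a : q != 0 -> (B <= a + n)%N -> (0 < a)%N ->
    ~ degle (lpoly q * h - lpoly p) (- (size q).-1%:Z - a.+1%:Z).
  by move=> q0 _ _; apply: (H B 1%N); rewrite ?leq_addl.
elim: n a p q => [|n IHn] a p q q0 Ba a0 qh.
  by apply: (hB p q q0); apply: degle_trans qh; lia.
have [p' qh'] := dilate_approximation q0 qh.
apply: IHn qh'; first exact: comp_Xn_neq0.
  by apply: leq_trans Ba _; nia.
by rewrite muln_gt0 d_gt0.
Qed.

(** If [q(1) = 0], then [q(x^d)] has the factor [x - 1] in common with
    [(x - 1) x^(d-2) p(x^d)], and cancelling it improves the approximation. *)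
Lemma denominator_root1 p q : poorly_approximable_by h 2 -> q != 0 ->
  degle (lpoly q * h - lpoly p) (- (size q).-1%:Z - 1) -> ~~ root q 1.
Proof.
move=> h2 q0 qh; apply/negP => q1.
have : root (q \Po 'X^d) 1 by rewrite /root horner_comp hornerXn expr1n.
case/factor_theorem=> r er; rewrite polyC1 in er.
have r0 : r != 0.
  by apply: contraNneq (comp_Xn_neq0 d_gt0 q0) => r0; rewrite er r0 mul0r.
apply: (h2 ('X^(d - 2) * (p \Po 'X^d)) r r0).
have -> : lpoly r * h - lpoly ('X^(d - 2) * (p \Po 'X^d)) =
    lpoly 'X^(d - 2) * dilate d (lpoly q * h - lpoly p).
  rewrite dilateD // dilateN // dilateM // !dilate_poly // er.
  rewrite {1}mahler_hE !rmorphM mulrBr /=; congr (_ - _).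
  exact: mul_regroup.
apply: degle_trans (degleM (degle_poly _) (degle_dilate d_gt0 qh)).
have := size_comp_Xn d q; rewrite er size_polyXn -polyC1.
rewrite size_polyM ?polyXsubC_eq0 // size_XsubC.
have : (0 < size r)%N by rewrite size_poly_gt0.
move: (size q).-1 (size r) => s m; rewrite -[X in (_ + X)%N]/2%N.
nia.
Qed.

End Mahler.

(** * Convergents of g *)

Lemma cf_monic_rec (K : fieldType) (u : laurent K) n (a : {poly K}) c :
  irrational u -> a \is monic -> pquot u n.+2 = c *: a ->
  convergent_denom u n.+2 = a * convergent_denom u n.+1 +
    (lead_coef (cfden u n) / lead_coef (cfden u n.+2))%:P *
      convergent_denom u n.
Proof.
move=> iu am ea; rewrite !convergent_denomE //.
have l0 m : lead_coef (cfden u m) != 0 by rewrite lead_coef_eq0 cfden_neq0.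
have l2 : lead_coef (cfden u n.+2) = c * lead_coef (cfden u n.+1).
  rewrite cfden_rec // lead_coefDl.
    by rewrite ea -scalerAl lead_coefZ lead_coef_monicM.
  have -> : size (pquot u n.+2 * cfden u n.+1) = size (cfden u n.+2).
    have a1 := size_pquot n.+1 iu.
    have a0 : pquot u n.+2 != 0 by rewrite -size_poly_gt0 ltnW.
    by rewrite size_cfdenS // size_polyM ?cfden_neq0 //; lia.
  exact: ltn_trans (size_cfden_lt n iu) (size_cfden_lt n.+1 iu).
have c0 : c != 0 by apply: contraNneq (l0 n.+2) => c0; rewrite l2 c0 mul0r.
rewrite {2}cfden_rec // ea scalerDr; congr (_ + _).
  rewrite -scalerAl scalerA -scalerAr l2 invfM mulrC mulrA.
  by rewrite divff // mul1r.
by rewrite mul_polyC scalerA mulrAC divff // mul1r.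
Qed.

Lemma convergent_denom_monic (K : fieldType) (u : laurent K) n (c : K)
    (q : {poly K}) : irrational u -> q \is monic -> c != 0 ->
  cfden u n = c *: q -> convergent_denom u n = q.
Proof.
move=> iu mq c0 eq; rewrite convergent_denomE // eq lead_coefZ (monicP mq).
by rewrite mulr1 scalerA mulVf // scale1r.
Qed.

Section Convergents_g.
Variable d : nat.
Hypothesis d_ge2 : (2 <= d)%N.
Hypothesis f_bad : badly_approximable (mahler_f d).

Let d_gt0 : (0 < d)%N := ltnW d_ge2.

Local Notation g := (mahler_g d).
Local Notation h := (mahler_h d).
Local Notation S := (\sum_(i < d) 'X^i : {poly rat}).

Let irr_g := irrational_mahler_g d_ge2.

Lemma poor_h : poorly_approximable_by h 2.
Proof.
have [B fB] := badly_approximableP (irrational_mahler_f d_ge2) f_bad.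
have hB := poorly_approximable_h d_ge2 fB.
exact: (@poorly_approximable_h2 d d_ge2 _ hB).
Qed.

Lemma irrational_h : irrational h.
Proof.
move=> p q q0 e; apply: (poor_h (p := p) q0).
by rewrite e subrr; exact: degle0.
Qed.

Lemma size_cfden_h k : size (cfden h k) = k.+1.
Proof.
elim: k => [|k IHk]; first by rewrite cfden0 size_poly1.
have ih := irrational_h; have := size_cfden_lt k ih; rewrite IHk => lt_k1.
apply/eqP; rewrite eqn_leq lt_k1 andbT leqNgt; apply/negP => lt_k.
apply: (poor_h (p := cfnum h k) (cfden_neq0 k ih)).
by apply: degle_trans (hasdeg_le (cf_error k ih)); rewrite IHk; lia.
Qed.

Lemma cfden_h_root1 k : ~~ root (cfden h k) 1.
Proof.
have ih := irrational_h.
apply: (denominator_root1 (p := cfnum h k) d_ge2 poor_h (cfden_neq0 k ih)).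
apply: degle_trans (hasdeg_le (cf_error k ih)); rewrite !size_cfden_h; lia.
Qed.

(** The error of [R_k(x^d)] for [g(x) = (x - 1) h(x^d)] has degree
    [1 - d (k + 1)]. *)
Lemma cf_g_ex k : exists n c, [/\ c != 0,
    cfden g n = c *: (cfden h k \Po 'X^d),
    cfnum g n = c *: (('X - 1) * (cfnum h k \Po 'X^d)),
    size (cfden g n) = (d * k).+1 & size (cfden g n.+1) = (d * k.+1)%N].
Proof.
have ih := irrational_h; pose q := cfden h k \Po 'X^d.
have q0 : q != 0 by apply: comp_Xn_neq0; rewrite ?cfden_neq0.
have sq : size q = (d * k).+1.
  have : (0 < size q)%N by rewrite size_poly_gt0.
  have := size_comp_Xn d (cfden h k); rewrite -/q size_cfden_h; lia.
have co : coprimep (('X - 1) * (cfnum h k \Po 'X^d)) q.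
  rewrite coprimepMl coprimep_comp_poly ?coprimep_cf // andbT.
  rewrite coprimep_sym -polyC1 coprimep_XsubC.
  by rewrite /root horner_comp hornerXn expr1n; exact: cfden_h_root1.
have [||n [c [c0 eq ep sn]]] :=
    @legendre_coprime _ g _ q (d * k.+1).-1 irr_g co q0.
- rewrite sq; nia.
- rewrite mahler_gE // rmorphM /= mulrCA -mulrBr -!dilate_poly //.
  rewrite -dilateM // -dilateN // -dilateD //.
  have X1 : hasdeg (lpoly ('X - 1 : {poly rat})) 1.
    have X0 : 'X - 1%:P != 0 :> {poly rat} by rewrite polyXsubC_eq0.
    by have := hasdeg_poly X0; rewrite size_XsubC polyC1.
  have := hasdegM X1 (hasdeg_dilate d_gt0 (cf_error k ih)).
  rewrite size_cfden_h; congr hasdeg; nia.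
exists n, c; split=> //; first by rewrite eq size_scale.
by rewrite sn prednK // muln_gt0 d_gt0.
Qed.

(** Between [deg Q_(2k) = d k] and [deg Q_(2k+2) = d (k + 1)] there is room for
    exactly one denominator, since the one that follows [Q_(2k)] has degree
    [d (k + 1) - 1]. *)
Lemma cf_g_even k : exists c, [/\ c != 0,
    cfden g (2 * k)%N = c *: (cfden h k \Po 'X^d),
    cfnum g (2 * k)%N = c *: (('X - 1) * (cfnum h k \Po 'X^d)),
    size (cfden g (2 * k)%N) = (d * k).+1 &
    size (cfden g (2 * k).+1) = (d * k.+1)%N].
Proof.
have lt_s := size_cfden_ltn _ _ irr_g.
elim: k => [|k [_ [_ _ _ _ IHk]]].
  have [n [c [c0 eq ep s0 s1]]] := cf_g_ex 0.
  have n0 : n = 0%N.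
    apply/eqP; rewrite -leqn0 leqNgt -lt_s s0 cfden0 size_poly1; lia.
  by rewrite n0 in eq ep s0 s1; exists c.
have [n [c [c0 eq ep s0 s1]]] := cf_g_ex k.+1.
have nk : n = (2 * k.+1)%N.
  have lt_n : ((2 * k).+1 < n)%N by rewrite -lt_s IHk s0.
  have : ~~ ((2 * k).+2 < n)%N.
    rewrite -lt_s s0 -leqNgt -IHk; exact: size_cfden_lt.
  lia.
by rewrite nk in eq ep s0 s1; exists c.
Qed.

(** The products of [Q_(2k+1)] and [P_(2k+1)] by the linear partial quotient
    [a_(2k+2)] are a polynomial in [x^d], and [x - 1] times such a polynomial.
    If the zero [z] of [a_(2k+2)] were not 1, both polynomials in [x^d] would
    vanish at [z], hence be divisible by [x^d - z^d], and then [P_(2k+1)] and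
    [Q_(2k+1)] would have the factor [(x^d - z^d) / (x - z)] in common. *)
Lemma pquot_g_even k : exists2 b, pquot g (2 * k).+2 = b *: ('X - 1) &
  S %| cfden g (2 * k).+1.
Proof.
have [c [_ eq ep s0 s1]] := cf_g_even k.
have [c' [_ eq' ep' s0' _]] := cf_g_even k.+1.
have e2 : (2 * k.+1 = (2 * k).+2)%N by lia.
rewrite e2 in eq' ep' s0'.
set a := pquot g (2 * k).+2; set Q := cfden g (2 * k).+1.
set P := cfnum g (2 * k).+1.
pose F := c' *: cfden h k.+1 - c *: cfden h k.
pose G := c' *: cfnum h k.+1 - c *: cfnum h k.
have eF : a * Q = F \Po 'X^d.
  by rewrite rmorphB /= !comp_polyZ -eq -eq' cfden_rec // addrK.
have eG : a * P = ('X - 1) * (G \Po 'X^d).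
  rewrite rmorphB /= !comp_polyZ mulrBr -!scalerAr -ep -ep'.
  by rewrite cfnum_rec // addrK.
have sa : size a = 2%N.
  have := size_cfdenS (2 * k).+1 irr_g; rewrite s0' s1 -/a.
  have := size_pquot (2 * k).+1 irr_g; rewrite -/a; lia.
have [b [z [b0 ea]]] : exists b z, b != 0 /\ a = b *: ('X - z%:P).
  have a1 : a`_1 != 0.
    rewrite -[1%N]/(2.-1) -sa -lead_coefE lead_coef_eq0.
    by rewrite -size_poly_gt0 sa.
  exists a`_1, (- a`_0 / a`_1); split=> //.
  rewrite scalerBr scale_polyC mulrC divfK // polyCN opprK.
  apply/polyP => -[|[|i]]; rewrite coefD coefZ coefX coefC.
  - by rewrite mulr0 add0r.
  - by rewrite mulr1 addr0.
  - by rewrite mulr0 addr0 nth_default // sa.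
have az : root a z by rewrite ea rootZ // root_XsubC.
have [T eT] : exists T, 'X^d - (z ^+ d)%:P = T * ('X - z%:P).
  apply/factor_theorem; by rewrite /root !hornerE subrr.
have sT : size T = d.
  have T0 : T != 0.
    apply: contraTneq (isT : (0 < d.+1)%N) => T0.
    by rewrite -(@size_XnsubC rat d (z ^+ d)) // eT T0 mul0r size_poly0.
  have := @size_XnsubC rat d (z ^+ d) d_gt0.
  rewrite eT size_Mmonic ?monicXsubC // size_XsubC addn2.
  by case.
have X0 : 'X - z%:P != 0 by rewrite polyXsubC_eq0.
have TQ : T %| Q.
  have : T * ('X - z%:P) %| F \Po 'X^d.
    by rewrite -eT dvdp_comp_Xn // -eF rootM az.
  by rewrite -eF ea -scalerAl dvdpZr // mulrC dvdp_mul2l.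
have z1 : z = 1.
  apply/eqP; apply: contraT => z1.
  have : T * ('X - z%:P) %| G \Po 'X^d.
    rewrite -eT dvdp_comp_Xn //.
    have : root (('X - 1) * (G \Po 'X^d)) z by rewrite -eG rootM az.
    by rewrite rootM -polyC1 root_XsubC (negPf z1).
  move=> /(dvdp_mull ('X - 1)); rewrite -eG ea -scalerAl dvdpZr // mulrC.
  rewrite dvdp_mul2l // => TP.
  have := coprimep_dvdl TQ (coprimep_dvdr TP (coprimep_cf g (2 * k).+1)).
  by rewrite coprimepp sT => /eqP d1; move: d_ge2; rewrite d1.
exists b; first by rewrite ea z1 polyC1.
have -> : S = T => //; apply: (mulIf X0).
by rewrite -eT z1 expr1n polyC1 subrX1 mulrC.
Qed.

Lemma size_geom : size S = d.
Proof.
have e := subrX1 ('X : {poly rat}) d; have := @size_XnsubC rat d 1 d_gt0.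
have S0 : S != 0.
  apply: contraTneq (isT : (0 < d.+1)%N) => S0.
  by rewrite -(@size_XnsubC rat d 1) // polyC1 e S0 mulr0 size_poly0.
rewrite polyC1 e -polyC1 size_monicM ?monicXsubC // size_XsubC.
by case.
Qed.

Lemma monic_geom : S \is monic.
Proof.
rewrite monicE lead_coefE size_geom coef_sum.
rewrite (bigD1 (Ordinal (_ : d.-1 < d)%N)) ?prednK //= => d1.
rewrite coefXn eqxx big1 ?addr0 // => i; rewrite -val_eqE /= coefXn eq_sym.
by move/negPf->.
Qed.

(** [S] divides [Q_(2k+1)] and [Q_(2k-1)], hence [a_(2k+1) Q_(2k)]; it is
    coprime to [Q_(2k)], a multiple of [R_k(x^d)], because [x^d = 1] modulo
    [S] and [R_k(1) <> 0]. *)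
Lemma pquot_g_odd k : exists b, pquot g (2 * k).+1 = b *: S.
Proof.
have [c [c0 eq _ s0 s1]] := cf_g_even k.
have Sa : S %| pquot g (2 * k).+1.
  have [_ _ SQ1] := pquot_g_even k.
  have : S %| pquot g (2 * k).+1 * cfden g (2 * k).
    case: k {c c0 eq s0 s1} SQ1 => [|k] SQ1.
      by move: SQ1; rewrite cfden1 // cfden0 mulr1.
    have [_ _ SQ] := pquot_g_even k; move: SQ1.
    have -> : (2 * k.+1 = (2 * k).+2)%N by lia.
    by rewrite cfden_rec // dvdp_addl.
  rewrite Gauss_dvdpl // eq coprimepZr //.
  have [r er] : exists r, cfden h k = r * ('X - 1) + (cfden h k).[1]%:P.
    have : root (cfden h k - (cfden h k).[1]%:P) 1.
      by rewrite /root !hornerE subrr.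
    by case/factor_theorem=> r er; exists r; rewrite -polyC1 -er subrK.
  rewrite er comp_polyD comp_polyM rmorphB /= comp_polyX !comp_polyC.
  rewrite polyC1 subrX1 mulrA coprimep_addl_mul -alg_polyC.
  by rewrite coprimepZr ?coprimep1 //; exact: cfden_h_root1.
have /eqpP [[b b'] /= /andP[b0 b'0] e] : pquot g (2 * k).+1 %= S.
  rewrite eqp_sym -dvdp_size_eqp // size_geom; apply/eqP.
  have := size_cfdenS (2 * k) irr_g; rewrite s0 s1.
  have := size_pquot (2 * k) irr_g; rewrite mulnS; move: (size _) => s; lia.
by exists (b^-1 * b'); rewrite -scalerA -e scalerA mulVf // scale1r.
Qed.

Lemma fps_factor_varX (K : fieldType) (s : fps K) n :
  (forall i, (i < n)%N -> fcoef s i = 0) -> exists t, s = fps_var ^+ n * t.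
Proof.
move=> s0; exists (FPS (fun i => fcoef s (i + n))); apply/fpsP => i.
by rewrite fcoef_var_mul /=; case: ltnP => [/s0|/subnK->].
Qed.

(** In [z = 1 / x] one has [(x + 1) h = (1 + z) (1 - z) f(z^d)]; as [d >= 2],
    the terms of degree 0 and 1 of this power series are 1 and 0. *)
Lemma mahler_h_approx : degle (lpoly ('X + 1%:P) * h - lpoly 1) (-2).
Proof.
pose s := fps_dilate d (mahler_series d).
have [t et] : exists t, s - 1 = fps_var ^+ 2 * t.
  apply: fps_factor_varX => -[|[|i]] // _; rewrite fcoefB fcoef1.
    by rewrite fcoef_dilate0 mahler_series0 // subrr.
  by rewrite subr0 /= dvdn1; case: eqP d_ge2 => // ->.
have e : (1 + fps_var) * mahler_series d - 1 = fps_var ^+ 2 * (t - s).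
  rewrite mahler_seriesE // -/s mulrBr -et mulrA [(1 + _) * _]mulrC.
  by rewrite -subr_sqr expr1n mulrBl mul1r addrAC.
exists (t - s); rewrite -[-2]/(- 2%:Z) -lser_var -rmorphM -e.
rewrite polyC1 [lpoly (_ + _)]rmorphD !rmorph1 /= lpolyX.
rewrite [RHS]rmorphB rmorphM rmorphD !rmorph1.
congr (_ - _); rewrite /mahler_h /mahler_f !mulrA; congr (_ * _).
have x0 : (lvar : laurent rat) != 0 by exact: lvar_neq0.
by rewrite mulrDl divff // mul1r /lvar invrK.
Qed.

(** [Q_2] is a multiple of [R_1(x^d)], and [R_1] of [x + 1], the only linear
    denominator that [mahler_h_approx] leaves possible. *)
Lemma convergent_denom_g2 : convergent_denom g 2 = 'X^d + 1.
Proof.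
have ih := irrational_h; have [c [c0 eq _ _ _]] := cf_g_even 1.
have X1m : 'X + 1%:P \is @monic rat by rewrite monicXaddC.
have sX1 : size ('X + 1%:P : {poly rat}) = 2%N by rewrite size_XaddC.
have [n [t [eX e1]]] :
    exists n t, 'X + 1%:P = t * cfden h n /\ 1 = t * cfnum h n.
  apply: (@legendre _ _ _ _ (-2)) => //.
  - exact: monic_neq0.
  - by rewrite sX1.
  exact: mahler_h_approx.
have t1 : size t = 1%N.
  apply/eqP; rewrite -dvdp1; apply/dvdpP; exists (cfnum h n).
  by rewrite mulrC.
have [b b0 et] : exists2 b, b != 0 & t = b%:P.
  by apply/size_poly1P; rewrite t1.
have n1 : n = 1%N.
  have := size_cfden_h n; have := sX1.
  by rewrite eX et mul_polyC size_scale // => ->; case.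
rewrite n1 et mul_polyC in eX.
apply: (@convergent_denom_monic _ _ _ (c / b)) => //.
- by rewrite -polyC1 monicXnaddC.
- by rewrite mulf_neq0 ?invr_eq0.
rewrite eq -scalerA; congr (_ *: _).
have -> : 'X^d + 1 = ('X + 1%:P) \Po 'X^d :> {poly rat}.
  by rewrite comp_polyD comp_polyX comp_polyC.
by rewrite eX comp_polyZ scalerA mulVf // scale1r.
Qed.

End Convergents_g.

Theorem theorem2 (d : nat) (hd : (2 <= d)%N) :
  badly_approximable (mahler_f d) ->
  exists beta : nat -> rat,
    let q := convergent_denom (mahler_g d) in
    [/\ q 1%N = \sum_(i < d) 'X^i,
        q 2%N = 'X^d + 1,
        (forall k : nat, (1 <= k)%N ->
           q (2 * k + 1)%N =
             (\sum_(i < d) 'X^i) * q (2 * k)%N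
             + (beta (2 * k + 1)%N)%:P * q (2 * k - 1)%N) &
        (forall k : nat,
           q (2 * k + 2)%N =
             ('X - 1) * q (2 * k + 1)%N
             + (beta (2 * k + 2)%N)%:P * q (2 * k)%N)].
Proof.
move=> f_bad; have ig := irrational_mahler_g hd.
pose l n := lead_coef (cfden (mahler_g d) n).
exists (fun n => l (n - 2)%N / l n) => q; split.
- have [b eb] := pquot_g_odd hd f_bad 0.
  have S_monic := monic_geom hd.
  apply: (convergent_denom_monic ig S_monic (c := b)).
    have := size_pquot 0 ig; rewrite eb; apply: contraTneq => ->.
    by rewrite scale0r size_poly0.
  by rewrite cfden1.
- exact: convergent_denom_g2.
- case=> // k _; have [b eb] := pquot_g_odd hd f_bad k.+1.
  have e1 : (2 * k.+1 = (2 * k).+2)%N by lia.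
  have e2 : (2 * k.+1 + 1 - 2 = (2 * k).+1)%N by lia.
  have e3 : (2 * k.+1 - 1 = (2 * k).+1)%N by lia.
  rewrite e2 e3 addn1 e1; rewrite e1 in eb.
  exact: cf_monic_rec ig (monic_geom hd) eb.
move=> k; have [b eb _] := pquot_g_even hd f_bad k.
rewrite addnK addn2 addn1; apply: cf_monic_rec ig _ eb.
by rewrite -polyC1 monicXsubC.
Qed.
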